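(* Let $\Phi=(A;\{E_i\}_{i=0}^d;A^*;\{E^*_i\}_{i=0}^d)$ be a tridiagonal system on $V$ with $d\ge1$, eigenvalue sequence $\{\theta_i\}_{i=0}^d$ and dual eigenvalue sequence $\{\theta^*_i\}_{i=0}^d$. Let $F$ be the $\Phi$-flat map, let $\mathcal R,\mathcal L$ be the $\Phi$-split raising and lowering maps, let $\{F_i\}_{i=0}^d$ be the projections for the $\Phi$-split decomposition, and put $T=\sum_{\ell=0}^dF_\ell E^*_\ell$. Define $$G_j=\theta_jI+\frac{\mathcal R\mathcal L}{\theta^*_j-\theta^*_{j-1}}+\frac{\mathcal L\mathcal R}{\theta^*_j-\theta^*_{j+1}}\quad(1\le j\le d-1),\qquad G_0=\theta_0I+\frac{\mathcal L\mathcal R}{\theta^*_0-\theta^*_1},\qquad G_d=\theta_dI+\frac{\mathcal R\mathcal L}{\theta^*_d-\theta^*_{d-1}}.$$ For $0\le j\le d$ the diagram with top map $F:E^*_jV\to E^*_jV$, bottom map $G_j:F_jV\to F_jV$, and both vertical maps $T:E^*_jV\to F_jV$ commutes; that is, $TFv=G_jTv$ for all $v\in E^*_jV$.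
   Context: Let $\mathbb F$ be a field and $V$ a nonzero finite-dimensional vector space over $\mathbb F$; $\mathrm{End}(V)$ is the algebra of $\mathbb F$-linear maps $V\to V$, with identity $I$. A tridiagonal pair on $V$ is an ordered pair $A,A^*\in\mathrm{End}(V)$ such that: (1) each of $A,A^*$ is diagonalizable; (2) there is an ordering $\{V_i\}_{i=0}^d$ of the eigenspaces of $A$ with $A^*V_i\subseteq V_{i-1}+V_i+V_{i+1}$ $(0\le i\le d)$, where $V_{-1}=V_{d+1}=0$; (3) there is an ordering $\{V^*_i\}_{i=0}^\delta$ of the eigenspaces of $A^*$ with $AV^*_i\subseteq V^*_{i-1}+V^*_i+V^*_{i+1}$ $(0\le i\le\delta)$, where $V^*_{-1}=V^*_{\delta+1}=0$; (4) there is no subspace $W\subseteq V$ with $W\ne0$, $W\ne V$, $AW\subseteq W$, $A^*W\subseteq W$. It is known that $d=\delta$. Orderings as in (2), (3) are called standard. For a diagonalizable map, the primitive idempotent attached to an eigenspace is the projection onto that eigenspace that vanishes on the other eigenspaces; an ordering of primitive idempotents is standard if the corresponding ordering of eigenspaces is. A tridiagonal system on $V$ is a sequence $\Phi=(A;\{E_i\}_{i=0}^d;A^*;\{E^*_i\}_{i=0}^d)$ where $A,A^*$ is a tridiagonal pair on $V$, $\{E_i\}$ is a standard ordering of the primitive idempotents of $A$, and $\{E^*_i\}$ is a standard ordering of the primitive idempotents of $A^*$. Let $\theta_i$ (resp. $\theta^*_i$) be the eigenvalue of $A$ (resp. $A^*$) for $E_i$ (resp. $E^*_i$); $\{\theta_i\}_{i=0}^d$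 and $\{\theta^*_i\}_{i=0}^d$ are the eigenvalue and dual eigenvalue sequences. Throughout $d\ge1$. Define $R=\sum_{i=0}^{d-1}E^*_{i+1}AE^*_i$, $F=\sum_{i=0}^dE^*_iAE^*_i$, $L=\sum_{i=1}^dE^*_{i-1}AE^*_i$ (the $\Phi$-raising, $\Phi$-flat, $\Phi$-lowering maps). $\Phi$-split decomposition: $U_i=(E^*_0V+\cdots+E^*_iV)\cap(E_iV+\cdots+E_dV)$ for $0\le i\le d$; it is known that $V=\sum_{i=0}^dU_i$ is a direct sum. $F_i\in\mathrm{End}(V)$ is the projection onto $U_i$ with $F_iU_j=0$ for $j\ne i$ (so $F_iV=U_i$). Define $\mathcal R=A-\sum_{i=0}^d\theta_iF_i$ (the $\Phi$-split raising map) and $\mathcal L=A^*-\sum_{i=0}^d\theta^*_iF_i$ (the $\Phi$-split lowering map). It is known that $\mathcal RF_iV\subseteq F_{i+1}V$, $\mathcal LF_iV\subseteq F_{i-1}V$ (with $F_{-1}V=F_{d+1}V=0$), and that $\sum_{\ell=0}^dF_\ell E^*_\ell$ is a bijection $V\to V$ sending $E^*_iV$ onto $F_iV$ for each $i$. *)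

(* Defs.v *)
From HB Require Import structures.
From mathcomp Require Import all_boot all_order all_algebra.

Set Implicit Arguments.
Unset Strict Implicit.
Unset Printing Implicit Defensive.

Import GRing.Theory passmx.
Local Open Scope ring_scope.

Definition diagonalizable_end (K : fieldType) (V : vectType K) (A : 'End(V)) :
    Prop :=
  exists s : seq K, (\sum_(a <- s) leigenspace A a)%VS = fullv.

Definition is_eigenspace (K : fieldType) (V : vectType K) (A : 'End(V))
    (W : {vspace V}) : Prop :=
  exists2 a : K, leigenvalue A a & W = leigenspace A a.

Definition eigenspace_ordering (K : fieldType) (V : vectType K) (A : 'End(V))
    (n : nat) (W : 'I_n -> {vspace V}) : Prop :=
  injective W /\ forall U : {vspace V}, is_eigenspace A U <-> exists i, U = W i.

(* The sum ranges over the j in {i - 1, i, i + 1} that are valid indices, which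
   amounts to setting the out-of-range terms V_{-1} and V_{d+1} to 0. *)
Definition standard_ordering (K : fieldType) (V : vectType K) (A B : 'End(V))
    (d : nat) (W : 'I_d.+1 -> {vspace V}) : Prop :=
  eigenspace_ordering A W /\
  forall i : 'I_d.+1,
    (B @: W i <= \sum_(j < d.+1 | (i <= j.+1)%N && (j <= i.+1)%N) W j)%VS.

Definition tridiagonal_pair (K : fieldType) (V : vectType K)
    (A As : 'End(V)) : Prop :=
  [/\ diagonalizable_end A /\ diagonalizable_end As,
      exists (d : nat) (W : 'I_d.+1 -> {vspace V}), standard_ordering A As W,
      exists (delta : nat) (Ws : 'I_delta.+1 -> {vspace V}),
        standard_ordering As A Ws
    & ~ exists W : {vspace V},
          [/\ W <> 0%VS, W <> fullv, (A @: W <= W)%VS & (As @: W <= W)%VS]].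

Definition primitive_idempotent (K : fieldType) (V : vectType K)
    (A : 'End(V)) (W : {vspace V}) (E : 'End(V)) : Prop :=
  [/\ is_eigenspace A W,
      limg E = W,
      forall v, v \in W -> E v = v
    & forall W', is_eigenspace A W' -> W' <> W ->
        forall v, v \in W' -> E v = 0].

Definition standard_idempotents (K : fieldType) (V : vectType K)
    (A B : 'End(V)) (d : nat) (E : 'I_d.+1 -> 'End(V)) : Prop :=
  exists W : 'I_d.+1 -> {vspace V},
    standard_ordering A B W /\ forall i, primitive_idempotent A (W i) (E i).

Definition tridiagonal_system (K : fieldType) (V : vectType K) (d : nat)
    (A : 'End(V)) (E : 'I_d.+1 -> 'End(V))
    (As : 'End(V)) (Es : 'I_d.+1 -> 'End(V)) : Prop :=
  [/\ tridiagonal_pair A As, standard_idempotents A As E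
    & standard_idempotents As A Es].

Definition eigenvalue_sequence (K : fieldType) (V : vectType K) (d : nat)
    (A : 'End(V)) (E : 'I_d.+1 -> 'End(V)) (th : 'I_d.+1 -> K) : Prop :=
  forall i, leigenvalue A (th i) /\ limg (E i) = leigenspace A (th i).

Definition flat_map (K : fieldType) (V : vectType K) (d : nat)
    (A : 'End(V)) (Es : 'I_d.+1 -> 'End(V)) : 'End(V) :=
  \sum_(i < d.+1) (Es i \o A \o Es i)%VF.

Definition split_space (K : fieldType) (V : vectType K) (d : nat)
    (E Es : 'I_d.+1 -> 'End(V)) (i : 'I_d.+1) : {vspace V} :=
  ((\sum_(j < d.+1 | (j <= i)%N) limg (Es j)) :&:
   (\sum_(j < d.+1 | (i <= j)%N) limg (E j)))%VS.

(* [sumv_pi] is defined for arbitrary sums of subspaces; [split_projP] below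
   says that it is the projection attached to the decomposition as soon as the
   sum is direct and equal to V. *)
Definition split_proj (K : fieldType) (V : vectType K) (d : nat)
    (E Es : 'I_d.+1 -> 'End(V)) (i : 'I_d.+1) : 'End(V) :=
  sumv_pi (\sum_(j < d.+1) split_space E Es j)%VS i.

Lemma split_projP (K : fieldType) (V : vectType K) (d : nat)
    (E Es : 'I_d.+1 -> 'End(V)) :
  directv (\sum_(j < d.+1) split_space E Es j) ->
  (\sum_(j < d.+1) split_space E Es j)%VS = fullv ->
  forall i : 'I_d.+1,
    [/\ limg (split_proj E Es i) = split_space E Es i,
        forall v, v \in split_space E Es i -> split_proj E Es i v = v
      & forall j, j != i ->
          forall v, v \in split_space E Es j -> split_proj E Es i v = 0].
Proof.
move=> dx sumV i.
have mem k v : split_proj E Es k v \in split_space E Es k.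
  exact: memv_sum_pi.
have key j v k : v \in split_space E Es j ->
    split_proj E Es k v = if k == j then v else 0.
  move=> vj.
  have sum1 : v = \sum_(l < d.+1) split_proj E Es l v.
    by rewrite sumv_pi_sum // sumV memvf.
  have sum2 : v = \sum_(l < d.+1) (if l == j then v else 0).
    by rewrite -big_mkcond big_pred1_eq.
  have mem2 l : l \in 'I_d.+1 ->
      (if l == j then v else 0) \in split_space E Es l.
    by case: eqP => [->|_] _; rewrite ?vj ?mem0v.
  have /directv_sum_unique/(_ (fun l => split_proj E Es l v)
    (fun l => if l == j then v else 0)) := dx.
  rewrite -sum1 -sum2 eqxx => H.
  have /esym/forall_inP/(_ k isT)/eqP := H (fun l _ => mem l v)
    (fun l _ => mem2 l isT).
  by [].
have idU v : v \in split_space E Es i -> split_proj E Es i v = v.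
  by move=> vi; rewrite (key i) // eqxx.
split=> // [|j ji v vj]; last by rewrite (key j) // eq_sym (negbTE ji).
apply/eqP; rewrite eqEsubv; apply/andP; split; apply/subvP=> v.
  by case/memv_imgP=> u _ ->.
by move=> vi; rewrite -(idU v vi) memv_img ?memvf.
Qed.

Definition split_raising (K : fieldType) (V : vectType K) (d : nat)
    (A : 'End(V)) (E Es : 'I_d.+1 -> 'End(V)) (th : 'I_d.+1 -> K) : 'End(V) :=
  A - \sum_(i < d.+1) th i *: split_proj E Es i.

Definition split_lowering (K : fieldType) (V : vectType K) (d : nat)
    (As : 'End(V)) (E Es : 'I_d.+1 -> 'End(V)) (ths : 'I_d.+1 -> K) :
    'End(V) :=
  As - \sum_(i < d.+1) ths i *: split_proj E Es i.

Definition split_transition (K : fieldType) (V : vectType K) (d : nat)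
    (E Es : 'I_d.+1 -> 'End(V)) : 'End(V) :=
  \sum_(l < d.+1) (split_proj E Es l \o Es l)%VF.

(* The raising-lowering term is absent for j = 0 and the lowering-raising term
   is absent for j = d; the indices j - 1 and j + 1 are only used in range. *)
Definition split_flat (K : fieldType) (V : vectType K) (d : nat)
    (th ths : 'I_d.+1 -> K) (calR calL : 'End(V)) (j : 'I_d.+1) : 'End(V) :=
  th j *: \1%VF
  + (if (0 < j)%N then
       (ths j - ths (inord j.-1))^-1 *: (calR \o calL)%VF else 0)
  + (if (j < d)%N then
       (ths j - ths (inord j.+1))^-1 *: (calL \o calR)%VF else 0).

(* Main.v *)
(* Let V_{ij} be the intersection of E*_0V + ... + E*_iV and E_jV + ... + E_dV,
   so that U_i = V_{ii}.  Since A - theta_j maps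
   V_{ij} into V_{i+1,j+1} and A* - theta*_i maps it into V_{i-1,j-1}, each sum
   along a diagonal is invariant under A and A*, so irreducibility gives
   V_{i-1,i} = 0 and V = U_0 + ... + U_d; the first makes the latter sum direct and
   gives E*_0V + ... + E*_iV = U_0 + ... + U_i.
   For w in E*_kV, the F_{k-1}-component of A*w = theta*_k w reads
   F_{k-1}w = (theta*_k - theta*_{k-1})^-1 L F_k w, with L the split lowering map.
   Let v be in E*_jV and w_k = E*_k A v.  The F_{j+1}-component of A v gives
   F_{j+1} w_{j+1} = R F_j v, and its F_j-component gives
   F_j w_j + F_j w_{j+1} = theta_j F_j v + R F_{j-1} v.  Applying the formula for
   F_{k-1}w to w_{j+1} and to v yields F_j w_j = G_j F_j v. *)
Require Import Defs.
From mathcomp Require Import all_boot all_order all_algebra.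
Import GRing.Theory.
Local Open Scope ring_scope.

Set Implicit Arguments.
Unset Strict Implicit.

(** * Idempotents of one half of a tridiagonal system *)

(** An interface that replaces eigenspaces and their orderings by identities between idempotents. It
    is used twice, with the roles of [A] and [As] exchanged. *)
Definition spectral_family (K : fieldType) (V : vectType K) (d : nat)
    (A B : 'End(V)) (E : 'I_d.+1 -> 'End(V)) (th : 'I_d.+1 -> K) : Prop :=
  [/\ injective th /\ forall i, limg (E i) != 0%VS,
      forall v, v = \sum_i E i v,
      forall i j v, E i (E j v) = if i == j then E i v else 0,
      forall i v, E i (A v) = th i *: E i v
    & forall i j : 'I_d.+1, ~~ ((i <= j.+1) && (j <= i.+1))%N ->
        forall v, E i (B (E j v)) = 0].

Lemma spectral_familyP (K : fieldType) (V : vectType K) (d : nat)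
    (A B : 'End(V)) (E : 'I_d.+1 -> 'End(V)) (th : 'I_d.+1 -> K) :
  diagonalizable_end A -> standard_idempotents A B E ->
  eigenvalue_sequence A E th -> spectral_family A B E th.
Proof.
case=> s sA [W [[[injW WE] tri] idE]] eigE.
have WlE i : W i = limg (E i) by case: (idE i).
have Wth i : W i = passmx.leigenspace A (th i) by rewrite WlE; case: (eigE i).
have inW i v : E i v \in W i by rewrite WlE memv_img ?memvf.
have Eeig i v : v \in W i -> A v = th i *: v.
  by rewrite Wth memv_ker !lfun_simp subr_eq0 => /eqP.
have EW i j v : v \in W j -> E i v = if i == j then v else 0.
  case: (idE i) => _ _ id0 id1; case: eqVneq => [ij | ij] vj; first by apply: id0; rewrite ij.
  apply: (id1 (W j)) => //; first by apply/WE; exists j.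
  by move=> /injW ji; rewrite ji eqxx in ij.
(* The list [s] may contain scalars that are not eigenvalues. Their eigenspaces are zero, and every
   other one is some [W i]. *)
have sumW : (\sum_i W i)%VS = fullv.
  apply/eqP; rewrite eqEsubv subvf -sA /=.
  elim/big_rec: _ => [|a U _ sU]; first exact: sub0v.
  rewrite subv_add sU andbT.
  have [-> | nz] := eqVneq (passmx.leigenspace A a) 0%VS; first exact: sub0v.
  have /WE[i ->] : is_eigenspace A (passmx.leigenspace A a) by exists a.
  exact: (sumv_sup i).
have sumE v : v = \sum_i E i v.
  have /memv_sumP[vs vsW ->] : v \in (\sum_i W i)%VS by rewrite sumW memvf.
  apply: eq_bigr => i _.
  rewrite linear_sum (bigD1 i) //= big1 ?addr0 ?(EW i i) ?eqxx ?vsW //.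
  by move=> k ki; rewrite (EW _ k) ?vsW // eq_sym (negbTE ki).
split=> //.
- split=> [i j thij | i]; first by apply: injW; rewrite !Wth thij.
  by case: (eigE i) => nz ->.
- by move=> i j v; rewrite (EW i j) //; case: eqP => // ->.
- move=> i v; rewrite {1}(sumE v) !linear_sum /= (bigD1 i) //= big1.
    by rewrite (Eeig i) // linearZ /= (EW i i) // eqxx addr0.
  by move=> k ki; rewrite (Eeig k) // linearZ /= (EW i k) // eq_sym (negbTE ki) scaler0.
- move=> i j ij v.
  have /memv_sumP[vs vsW ->] := subvP (tri j) _ (memv_img B (inW j v)).
  rewrite linear_sum big1 // => k jk /=; rewrite (EW i k) ?vsW //.
  by case: eqP => // ik; rewrite ik andbC jk in ij.
Qed.

Section SpectralFamily.
Variables (K : fieldType) (V : vectType K) (d : nat).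
Variables (A B : 'End(V)) (E : 'I_d.+1 -> 'End(V)) (th : 'I_d.+1 -> K).
Hypothesis spE : spectral_family A B E th.

Lemma mem_limg_idem i v : (v \in limg (E i)) = (E i v == v).
Proof.
case: spE => _ _ EE _ _; apply/idP/eqP => [/memv_imgP[u _ ->] | <-].
  by rewrite EE eqxx.
exact: memv_img (memvf v).
Qed.

(** Used to describe corners by vanishing components, so that no decomposition of a vector has to be
    carried along. *)
Lemma memv_sum_limg (P : pred 'I_d.+1) v :
  v \in (\sum_(j | P j) limg (E j))%VS <-> forall k, ~~ P k -> E k v = 0.
Proof.
case: spE => _ sumE EE _ _; split=> [/memv_sumP[vs vsE ->] k kP | v0].
  rewrite linear_sum big1 //= => i iP.
  move: (vsE i iP); rewrite mem_limg_idem => /eqP <-.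
  by rewrite EE; case: eqP => // ki; rewrite ki iP in kP.
apply/memv_sumP; exists (E^~ v) => [i _ |]; first exact: memv_img (memvf v).
by rewrite {1}(sumE v) (bigID P) /= [X in _ + X]big1 ?addr0.
Qed.

Lemma idem_tridiag_eq0 (k : 'I_d.+1) v :
  (forall j : 'I_d.+1, (k <= j.+1)%N -> (j <= k.+1)%N -> E j v = 0) ->
  E k (B v) = 0.
Proof.
case: spE => _ sumE _ _ tri v0; rewrite (sumE v) !linear_sum big1 //= => j _.
have [/andP[kj jk] | ?] := boolP ((k <= j.+1) && (j <= k.+1))%N; last exact: tri.
by rewrite v0 // !linear0.
Qed.

Lemma idem_eq0 v : (forall k, E k v = 0) -> v = 0.
Proof. by case: spE => _ sumE _ _ _ v0; rewrite (sumE v) big1. Qed.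

End SpectralFamily.

(** * Corners and the action of both maps on them *)

Section TridiagonalSystem.
Variables (K : fieldType) (V : vectType K) (d : nat).
Variables (A As : 'End(V)) (E Es : 'I_d.+1 -> 'End(V)).
Variables (th ths : 'I_d.+1 -> K).
Hypothesis spE : spectral_family A As E th.
Hypothesis spEs : spectral_family As A Es ths.
Hypothesis irr : forall W : {vspace V},
  (A @: W <= W)%VS -> (As @: W <= W)%VS -> W = 0%VS \/ W = fullv.

(* In the paper's notation this is V_{m-1,n}; with half-open bounds the boundary
   cases m = 0 and n = d + 1 give the zero space without any side condition. *)
Definition corner (m n : nat) : {vspace V} :=
  ((\sum_(j < d.+1 | (j < m)%N) limg (Es j)) :&:
   (\sum_(j < d.+1 | (n <= j)%N) limg (E j)))%VS.

Lemma cornerP m n v : reflect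
  ((forall k : 'I_d.+1, (m <= k)%N -> Es k v = 0) /\
   (forall k : 'I_d.+1, (k < n)%N -> E k v = 0)) (v \in corner m n).
Proof.
rewrite memv_cap; apply: (iffP andP).
  case=> /(memv_sum_limg spEs) lo /(memv_sum_limg spE) up.
  by split=> k km; [apply: lo | apply: up]; rewrite -?leqNgt -?ltnNge.
case=> lo up; split.
  by apply/(memv_sum_limg spEs) => k; rewrite -leqNgt; apply: lo.
by apply/(memv_sum_limg spE) => k; rewrite -ltnNge; apply: up.
Qed.

Lemma corner_low0 n : corner 0 n = 0%VS.
Proof.
apply/eqP; rewrite -subv0; apply/subvP => v /cornerP[lo _].
by rewrite memv0; apply/eqP/(idem_eq0 spEs) => k; apply: lo.
Qed.

Lemma corner_up0 m n : (d < n)%N -> corner m n = 0%VS.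
Proof.
move=> dn; apply/eqP; rewrite -subv0; apply/subvP => v /cornerP[_ up].
by rewrite memv0; apply/eqP/(idem_eq0 spE) => k; apply/up/(leq_trans (ltn_ord k)).
Qed.

(** [A - th i] kills the [E i] component, which moves the lower bound up. On the dual side [A] is
    tridiagonal, so the upper bound grows by at most one. *)
Lemma corner_raise m (i : 'I_d.+1) v :
  v \in corner m i -> A v - th i *: v \in corner m.+1 i.+1.
Proof.
case: (spE) => _ _ _ EA _.
case/cornerP=> lo up; apply/cornerP; split=> k; rewrite linearB linearZ /=.
  move=> mk; rewrite (lo k (ltnW mk)) scaler0 subr0.
  apply: (idem_tridiag_eq0 spEs) => j kj _; exact/lo/(leq_trans mk kj).
rewrite EA -scalerBl ltnS leq_eqVlt => /orP[/eqP/val_inj -> | /up ->].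
  by rewrite subrr scale0r.
by rewrite scaler0.
Qed.

Lemma corner_lower (i : 'I_d.+1) n v :
  v \in corner i.+1 n -> As v - ths i *: v \in corner i n.-1.
Proof.
case: (spEs) => _ _ _ EA _.
case/cornerP=> lo up; apply/cornerP; split=> k; rewrite linearB linearZ /=.
  rewrite EA -scalerBl leq_eqVlt => /orP[/eqP/val_inj -> | /lo ->].
    by rewrite subrr scale0r.
  by rewrite scaler0.
(* For [n = 0] the truncated predecessor is 0, so [kn] is already absurd. *)
move=> kn; have kn' : (k.+1 < n)%N by case: n kn {lo up} => [|[]].
rewrite up ?(ltnW kn') // scaler0 subr0.
apply: (idem_tridiag_eq0 spE) => j _ jk; exact/up/(leq_ltn_trans jk).
Qed.

(** * Invariant sums along diagonals *)

Definition diagonal_sum (r : nat) : {vspace V} :=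
  (\sum_(i < d.+1) corner i.+1 (i + r))%VS.

(** Here [m] may exceed [d], where the corner is zero; raising out of the last corner then needs no
    separate case. *)
Lemma corner_sub_diagonal_sum m r :
  (corner m.+1 (m + r) <= diagonal_sum r)%VS.
Proof.
have [md | dm] := ltnP m d.+1; first exact: (sumv_sup (Ordinal md)).
by rewrite corner_up0 ?sub0v // (leq_trans dm) // leq_addr.
Qed.

Lemma diagonal_sum_stable r :
  (A @: diagonal_sum r <= diagonal_sum r)%VS /\
  (As @: diagonal_sum r <= diagonal_sum r)%VS.
Proof.
have sub i v : v \in corner i.+1 (i + r) -> v \in diagonal_sum r.
  exact/subvP/corner_sub_diagonal_sum.
split; rewrite limg_sum; apply/subv_sumP => i _;
  apply/subvP => _ /memv_imgP[v vi ->].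
  (* Past [d] there is no eigenvalue to subtract, but the corner is zero. *)
  have [ird | dir] := ltnP (i + r) d.+1; last first.
    by move: vi; rewrite corner_up0 // memv0 => /eqP ->; rewrite linear0 mem0v.
  rewrite -(subrK (th (Ordinal ird) *: v) (A v)) memvD //.
    by apply: (sub i.+1); rewrite addSn; apply: (corner_raise (i := Ordinal ird)).
  by rewrite memvZ // (sub i).
rewrite -(subrK (ths i *: v) (As v)) memvD //; last by rewrite memvZ // (sub i).
have := corner_lower vi; case: (i : nat) => [|m]; last by rewrite addSn; apply: sub.
by rewrite corner_low0 memv0 => /eqP ->; apply: mem0v.
Qed.

Lemma idem_nonzero i : exists v, Es i v != 0.
Proof.
case: (spEs) => -[_ /(_ i) nz] _ _ _ _.
by exists (vpick (limg (Es i))); move: (memv_pick (limg (Es i)));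
  rewrite (mem_limg_idem spEs) => /eqP ->; rewrite vpick0.
Qed.

(* The last summand of [diagonal_sum 1] vanishes, so it misses the last dual
   eigenspace; being invariant it is zero. *)
Lemma corner_diag0 n : corner n n = 0%VS.
Proof.
case: n => [|n]; first exact: corner_low0.
have [st sts] := diagonal_sum_stable 1.
case: (irr st sts) => [W0 | WV].
  apply/eqP; rewrite -subv0 -W0.
  by have := corner_sub_diagonal_sum n 1; rewrite addn1.
have [v /eqP nz] := idem_nonzero ord_max; case: nz.
have : v \in diagonal_sum 1 by rewrite WV memvf.
case/memv_sumP=> vs vsU ->; rewrite linear_sum big1 // => i _ /=.
have /cornerP[lo up] := vsU i isT.
have [id | di] := ltnP i d; first exact: lo.
suff -> : vs i = 0 by rewrite linear0.
apply: (idem_eq0 spE) => k; apply: up; by rewrite addn1 ltnS -ltnS (leq_trans (ltn_ord k)).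
Qed.

(** * The split decomposition *)

Lemma split_spaceP i v : v \in split_space E Es i ->
  (forall k : 'I_d.+1, (i < k)%N -> Es k v = 0) /\
  (forall k : 'I_d.+1, (k < i)%N -> E k v = 0).
Proof. by move/(cornerP i.+1 i). Qed.

(** The main diagonal gives an invariant space containing [corner 1 0], which is the nonzero space
    E*_0V; irreducibility does the rest. *)
Lemma sum_split_space : (\sum_(i < d.+1) split_space E Es i)%VS = fullv.
Proof.
have -> : (\sum_(i < d.+1) split_space E Es i)%VS = diagonal_sum 0.
  by apply: eq_bigr => i _; rewrite addn0.
have [st sts] := diagonal_sum_stable 0.
case: (irr st sts) => // W0.
have [v /eqP nz] := idem_nonzero ord0; case: nz; apply/eqP.
rewrite -memv0 -W0; apply: (subvP (corner_sub_diagonal_sum 0 0)).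
apply/cornerP; split=> // k k0; case: (spEs) => _ _ -> _ _.
by case: eqP => // kE; rewrite kE in k0.
Qed.

(** In a vanishing sum take the largest [i] with [us i] nonzero. Being minus the sum of the earlier
    terms, [us i] has no dual component from [i] on, so it lies in [corner i i], which is zero. *)
Lemma directv_split_space : directv (\sum_(i < d.+1) split_space E Es i).
Proof.
apply/directv_sum_independent => us usU sum0 i0 _.
apply/eqP; apply: contraT => nz0.
case: (@arg_maxnP _ i0 (fun i => us i != 0) (@nat_of_ord _) nz0) => i nzi maxi.
rewrite -(negbTE nzi) -memv0 -(corner_diag0 i).
have /split_spaceP[_ up] := usU i isT.
apply/cornerP; split=> // k ik.
move/eqP: sum0; rewrite (bigD1 i) //= addr_eq0 => /eqP ->.
rewrite linearN linear_sum big1 ?oppr0 //= => j ji.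
have [-> | nzj] := eqVneq (us j) 0; first exact: linear0.
have /split_spaceP[lo _] := usU j isT; apply: lo; apply: leq_trans ik.
by rewrite ltn_neqAle ji; apply: maxi.
Qed.

(** * Split projections and the split raising and lowering maps *)

Local Notation Fp := (split_proj E Es).
Local Notation calR := (split_raising A E Es th).
Local Notation calL := (split_lowering As E Es ths).

Lemma split_proj_mem i v : Fp i v \in split_space E Es i.
Proof. exact: memv_sum_pi. Qed.

Lemma split_proj_mem_eq i k v :
  v \in split_space E Es i -> Fp k v = if k == i then v else 0.
Proof.
have [_ id0 id1] := split_projP directv_split_space sum_split_space k.
case: eqVneq => [-> | ki] vi; last by apply: (id1 i); rewrite // eq_sym.
by have [_ ->] := split_projP directv_split_space sum_split_space i.
Qed.

Lemma sum_split_proj v : v = \sum_i Fp i v.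
Proof. by rewrite sumv_pi_sum // sum_split_space memvf. Qed.

Lemma split_proj_low_eq0 m v (k : 'I_d.+1) :
  (forall j : 'I_d.+1, (m <= j)%N -> Es j v = 0) -> (m <= k)%N -> Fp k v = 0.
Proof.
(* The part [x] of [v] in U_m + ... + U_d has no [E] component below [m]. It differs from [v] by an
   element of U_0 + ... + U_{m-1}, so it has no dual component from [m] on either. Hence it lies in
   [corner m m]. *)
move=> lo mk; pose x := \sum_(i < d.+1 | (m <= i)%N) Fp i v.
have xE : x = v - \sum_(i < d.+1 | ~~ (m <= i)%N) Fp i v.
  by rewrite {1}(sum_split_proj v) (bigID (fun i : 'I_d.+1 => m <= i)%N) /= addrK.
have x0 : x = 0.
  apply/eqP; rewrite -memv0 -(corner_diag0 m); apply/cornerP; split=> j mj.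
    rewrite xE linearB linear_sum /= lo // big1 ?subrr // => i; rewrite -ltnNge.
    move=> im; have /split_spaceP[-> //] := split_proj_mem i v.
    exact: leq_trans mj.
  rewrite linear_sum big1 //= => i mi.
  by have /split_spaceP[_ -> //] := split_proj_mem i v; apply: leq_trans mi.
have <- : Fp k x = Fp k v.
  rewrite linear_sum (bigD1 k) //= (split_proj_mem_eq _ (split_proj_mem k v)) eqxx.
  rewrite big1 ?addr0 // => i /andP[_ ik].
  by rewrite (split_proj_mem_eq _ (split_proj_mem i v)) eq_sym (negbTE ik).
by rewrite x0 linear0.
Qed.

Lemma split_proj_orth i k v : Fp k (Fp i v) = if k == i then Fp i v else 0.
Proof. exact/split_proj_mem_eq/split_proj_mem. Qed.

Lemma sum_scale_split_proj (a : 'I_d.+1 -> K) k v :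
  Fp k ((\sum_i a i *: Fp i) v) = a k *: Fp k v /\
  (\sum_i a i *: Fp i) (Fp k v) = a k *: Fp k v.
Proof.
rewrite !sum_lfunE linear_sum; split; rewrite (bigD1 k) //= big1 => [|i ik].
- by rewrite scale_lfunE linearZ /= split_proj_orth eqxx addr0.
- by rewrite scale_lfunE linearZ /= split_proj_orth eq_sym (negbTE ik) scaler0.
- by rewrite scale_lfunE split_proj_orth eqxx addr0.
- by rewrite scale_lfunE split_proj_orth (negbTE ik) scaler0.
Qed.

Lemma split_projA k v : Fp k (A v) = th k *: Fp k v + Fp k (calR v).
Proof.
rewrite add_lfunE opp_lfunE linearB /= (sum_scale_split_proj th k v).1.
by rewrite addrC subrK.
Qed.

Lemma split_projAs k v : Fp k (As v) = ths k *: Fp k v + Fp k (calL v).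
Proof.
rewrite add_lfunE opp_lfunE linearB /= (sum_scale_split_proj ths k v).1.
by rewrite addrC subrK.
Qed.

Lemma split_proj_raising (i k : 'I_d.+1) v :
  Fp k (calR (Fp i v)) = if k == i.+1 :> nat then calR (Fp i v) else 0.
Proof.
(* On U_i the map [calR] is [A - th i]. The target corner is U_{i+1} for [i < d] and zero for
   [i = d]. *)
have vi : calR (Fp i v) \in corner i.+2 i.+1.
  rewrite add_lfunE opp_lfunE (sum_scale_split_proj th i v).2.
  exact/corner_raise/split_proj_mem.
have [id | di] := ltnP i.+1 d.+1.
  by rewrite (split_proj_mem_eq (i := Ordinal id) k vi).
move: vi; rewrite corner_up0 // memv0 => /eqP ->.
by rewrite linear0; case: ifP.
Qed.

Lemma split_proj_lowering (i k : 'I_d.+1) v :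
  Fp k (calL (Fp i v)) = if k.+1 == i :> nat then calL (Fp i v) else 0.
Proof.
have : calL (Fp i v) \in corner i i.-1.
  rewrite add_lfunE opp_lfunE (sum_scale_split_proj ths i v).2.
  exact/corner_lower/split_proj_mem.
case: i => -[|i] lti /= vi.
  by move: vi; rewrite corner_low0 memv0 => /eqP ->; apply: linear0.
exact: (split_proj_mem_eq (i := Ordinal (ltnW lti)) k vi).
Qed.

Lemma split_projR (i k : 'I_d.+1) v :
  k = i.+1 :> nat -> Fp k (calR v) = calR (Fp i v).
Proof.
move=> ki; rewrite {1}(sum_split_proj v) !linear_sum /= (bigD1 i) //= big1.
  by rewrite split_proj_raising ki eqxx addr0.
by move=> j ji; rewrite split_proj_raising ki eqSS eq_sym val_eqE (negbTE ji).
Qed.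

Lemma split_projR0 v : Fp ord0 (calR v) = 0.
Proof.
rewrite {1}(sum_split_proj v) !linear_sum big1 // => i _ /=.
exact: split_proj_raising.
Qed.

Lemma split_projL (i k : 'I_d.+1) v :
  k.+1 = i :> nat -> Fp k (calL v) = calL (Fp i v).
Proof.
move=> ki; rewrite {1}(sum_split_proj v) !linear_sum /= (bigD1 i) //= big1.
  by rewrite split_proj_lowering ki eqxx addr0.
by move=> j ji; rewrite split_proj_lowering ki eq_sym val_eqE (negbTE ji).
Qed.

(** * Comparison of the flat map with its split counterpart *)

Lemma split_proj_eigen (i k : 'I_d.+1) w :
  i.+1 = k :> nat -> w \in limg (Es k) ->
  Fp i w = (ths k - ths i)^-1 *: calL (Fp k w).
Proof.
move=> ik; rewrite (mem_limg_idem spEs) => /eqP wk.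
case: (spEs) => -[injths _] sumEs EsEs EsAs _.
have nz : ths k - ths i != 0.
  by rewrite subr_eq0; apply: contra_eqN ik => /eqP/injths ->; rewrite gtn_eqF.
have Asw : As w = ths k *: w.
  rewrite (sumEs (As w)) (bigD1 k) //= EsAs wk big1 ?addr0 // => j jk.
  by rewrite EsAs -wk EsEs (negbTE jk) scaler0.
(* The [Fp i] component of [As w = ths k *: w], to be solved for [Fp i w]. *)
have := split_projAs i w; rewrite Asw linearZ /= (split_projL _ ik) => /eqP.
rewrite addrC -subr_eq -scalerBl => /eqP <-.
by rewrite scalerA mulVf // scale1r.
Qed.

Lemma split_transitionE j v :
  v \in limg (Es j) -> split_transition E Es v = Fp j v.
Proof.
case: (spEs) => _ _ EsEs _ _; rewrite (mem_limg_idem spEs) => /eqP <-.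
rewrite sum_lfunE (bigD1 j) //= big1 => [|i ij].
  by rewrite comp_lfunE EsEs eqxx addr0.
by rewrite comp_lfunE EsEs (negbTE ij) linear0.
Qed.

Lemma flat_mapE j v : v \in limg (Es j) -> flat_map A Es v = Es j (A v).
Proof.
case: (spEs) => _ _ EsEs _ _; rewrite (mem_limg_idem spEs) => /eqP vj.
rewrite sum_lfunE (bigD1 j) //= big1 => [|i ij].
  by rewrite !comp_lfunE vj addr0.
by rewrite !comp_lfunE -vj EsEs (negbTE ij) !linear0.
Qed.

Lemma split_flatE (R L : 'End(V)) j v :
  split_flat th ths R L j v = th j *: v
  + (if (0 < j)%N then
       (ths j - ths (inord j.-1))^-1 *: R (L v) else 0)
  + (if (j < d)%N then
       (ths j - ths (inord j.+1))^-1 *: L (R v) else 0).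
Proof.
rewrite /split_flat !add_lfunE scale_lfunE id_lfunE; congr (_ + _ + _);
  by case: ifP; rewrite ?zero_lfunE // scale_lfunE comp_lfunE.
Qed.

(** Each product goes one step along the decomposition and back, so on U_j it agrees with its own
    [Fp j] component. *)
Lemma split_flat_stable j v :
  v \in split_space E Es j ->
  split_flat th ths calR calL j v \in split_space E Es j.
Proof.
move=> vj; have jv : v = Fp j v by rewrite (split_proj_mem_eq _ vj) eqxx.
rewrite split_flatE; apply: memvD; first apply: memvD.
- exact: memvZ.
- case: ifP => j0; last exact: mem0v.
  have ji : (inord j.-1 : 'I_d.+1) = j.-1 :> nat by rewrite inordK // prednK // ltnW.
  rewrite memvZ // {1}jv -(@split_projL _ (inord j.-1)) ?ji ?prednK //.
  by rewrite -(@split_projR _ j) ?split_proj_mem // ji prednK.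
- case: ifP => jd; last exact: mem0v.
  have ji : (inord j.+1 : 'I_d.+1) = j.+1 :> nat by rewrite inordK.
  rewrite memvZ // {1}jv -(@split_projR _ (inord j.+1)) ?ji //.
  by rewrite -(@split_projL _ j) ?split_proj_mem // ji.
Qed.

Lemma split_proj_flat j v :
  v \in limg (Es j) -> Fp j (Es j (A v)) = split_flat th ths calR calL j (Fp j v).
Proof.
move=> vj; case: (spEs) => _ sumEs EsEs _ tri.
have Esv i : Es i v = if i == j then v else 0.
  by move: vj; rewrite (mem_limg_idem spEs) => /eqP <-; rewrite EsEs; case: eqP => // ->.
have AEv (k : 'I_d.+1) : (j.+1 < k)%N -> Es k (A v) = 0.
  move=> jk; apply: (idem_tridiag_eq0 spEs) => i ki _; rewrite Esv.
  by case: eqP ki => // ->; rewrite leqNgt jk.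
have lowEs (i k : 'I_d.+1) w : (k < i)%N -> Fp i (Es k w) = 0.
  move=> ki; apply: split_proj_low_eq0 ki => l kl.
  by rewrite EsEs -val_eqE gtn_eqF.
have upv (i : 'I_d.+1) : (j < i)%N -> Fp i v = 0.
  by move=> ji; have := lowEs i j v ji; rewrite Esv eqxx.
(* [Fp i] kills E*_kV for [k < i], and [A v] has no dual component beyond [j.+1]; only this window
   survives. *)
have FAv (i : 'I_d.+1) :
    Fp i (A v) = \sum_(k < d.+1 | (i <= k <= j.+1)%N) Fp i (Es k (A v)).
  rewrite {1}(sumEs (A v)) linear_sum [RHS]big_mkcond; apply: eq_bigr => k _ /=.
  case: ifPn => //; rewrite negb_and -!ltnNge => /orP[ki | jk].
    exact: lowEs.
  by rewrite AEv ?linear0.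
have split_up : Fp j (Es j (A v)) + (if (j < d)%N then
    Fp j (Es (inord j.+1) (A v)) else 0) = th j *: Fp j v + Fp j (calR v).
  rewrite -split_projA FAv (bigD1 j) ?leqnn ?leqnSn //=; congr (_ + _).
  case: ifP => [jd | dj].
    rewrite (big_pred1 (inord j.+1)) // => k.
    have ji : j.+1 = (inord j.+1 : 'I_d.+1) by rewrite inordK.
    rewrite /= -!val_eqE /= -ji andbAC [RHS]eq_sym [RHS]eqn_leq; congr (_ && _).
    by rewrite ltn_neqAle andbC eq_sym.
  rewrite big1 // => k /andP[/andP[jk _] kj].
  have : (j < k)%N by rewrite ltn_neqAle eq_sym kj.
  by move/leq_trans/(_ (ltn_ord k : (k <= d)%N)); rewrite dj.
have FR : Fp j (calR v) = if (0 < j)%N then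
    (ths j - ths (inord j.-1))^-1 *: calR (calL (Fp j v)) else 0.
  case: ifPn => [j0 | ]; last first.
    by rewrite -eqn0Ngt => /eqP j0; rewrite (_ : j = ord0) ?split_projR0 //; apply: val_inj.
  have ji : (inord j.-1 : 'I_d.+1).+1 = j.
    by rewrite inordK ?prednK // ltnW.
  by rewrite (@split_projR (inord j.-1)) // (split_proj_eigen ji vj) linearZ.
rewrite split_flatE -FR -split_up -addrA; case: ifP => jd; rewrite ?addr0 //.
have ji : j.+1 = (inord j.+1 : 'I_d.+1) by rewrite inordK.
(* It remains to see that the two extra terms cancel: both are multiples of [calL (calR (Fp j v))],
   with coefficients inverse to opposite differences of [ths]. *)
rewrite -[LHS]addr0; congr (_ + _); rewrite (split_proj_eigen ji).
  have -> : Fp (inord j.+1) (Es (inord j.+1) (A v)) = calR (Fp j v).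
    transitivity (Fp (inord j.+1) (A v)).
      rewrite FAv (big_pred1 (inord j.+1)) // => k.
      by rewrite /= -val_eqE /= -ji eq_sym eqn_leq.
    by rewrite split_projA upv -?ji // scaler0 add0r (@split_projR j).
  by rewrite -scalerDl -opprB invrN addNr scale0r.
by rewrite (mem_limg_idem spEs) EsEs eqxx.
Qed.

End TridiagonalSystem.

(** * The commuting diagram for a tridiagonal system *)

Unset Implicit Arguments.
Set Strict Implicit.

Theorem theorem8p10 (K : fieldType) (V : vectType K)
    (V_neq0 : (fullv : {vspace V}) <> 0%VS)
    (d : nat) (d_ge1 : (1 <= d)%N)
    (A : 'End(V)) (E : 'I_d.+1 -> 'End(V))
    (As : 'End(V)) (Es : 'I_d.+1 -> 'End(V))
    (Phi : tridiagonal_system A E As Es)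
    (th ths : 'I_d.+1 -> K)
    (th_eig : eigenvalue_sequence A E th)
    (ths_eig : eigenvalue_sequence As Es ths) :
  let F := flat_map A Es in
  let Fp := split_proj E Es in
  let calR := split_raising A E Es th in
  let calL := split_lowering As E Es ths in
  let T := split_transition E Es in
  let G := split_flat th ths calR calL in
  forall j : 'I_d.+1,
    [/\ (F @: limg (Es j) <= limg (Es j))%VS,
        (G j @: limg (Fp j) <= limg (Fp j))%VS,
        (T @: limg (Es j) <= limg (Fp j))%VS
      & forall v : V, v \in limg (Es j) -> T (F v) = G j (T v)].
Proof.
move=> F Fp calR calL T G j.
have [[[dA dAs] _ _ irr] sA sAs] := Phi.
have spE := spectral_familyP dA sA th_eig.
have spEs := spectral_familyP dAs sAs ths_eig.
have irr' (W : {vspace V}) :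
    (A @: W <= W)%VS -> (As @: W <= W)%VS -> W = 0%VS \/ W = fullv.
  move=> WA WAs; case: (eqVneq W 0%VS) => [|/eqP W0]; first by left.
  case: (eqVneq W fullv) => [|/eqP W1]; first by right.
  by case: irr; exists W.
have FpE : limg (Fp j) = split_space E Es j.
  have dx := directv_split_space spE spEs irr'.
  by have [] := split_projP dx (sum_split_space spE spEs irr') j.
have FE := flat_mapE (A := A) spEs; have TE := split_transitionE E spEs.
have memEs v : Es j v \in limg (Es j) by rewrite memv_img ?memvf.
split; last by move=> v vj; rewrite /F (FE j) // /T !(TE j) //; apply: split_proj_flat.
- by apply/subvP => _ /memv_imgP[v vj ->]; rewrite /F (FE j).
- apply/subvP => _ /memv_imgP[v vj ->]; move: vj; rewrite FpE.
  exact: split_flat_stable.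
- by apply/subvP => _ /memv_imgP[v vj ->]; rewrite /T (TE j) // memv_img ?memvf.
Qed.
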